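(* Let $a,b,c\geq 0$ be real numbers and let $$\delta=\begin{pmatrix}1&-a&-b\\-a&1&-c\\-b&-c&1\end{pmatrix}.$$ Then the following assertions are equivalent: \begin{itemize} \item There exists a (non-degenerate) small step model $\mathcal{S}$ in dimension $3$ such that $\delta=\mathrm{cov}(\chi_{\mathcal{S}})$; \item $a^2+b^2+c^2+2abc<1$; \item The matrix $\delta$ is positive definite. \end{itemize}
   Context: A small step model in dimension $3$ is a set $\mathcal{S}\subset\{-1,0,1\}^3$ together with weights $w(s)\geq 0$ ($s\in\mathcal{S}$) such that $\sum_{s\in\mathcal{S}}w(s)=1$ and $\sum_{s\in\mathcal{S}}w(s)s=0$. It is non-degenerate if $\{s\in\mathcal{S}:w(s)>0\}$ spans $\mathbb{R}^3$. Its inventory polynomial is the Laurent polynomial $\chi_{\mathcal{S}}(x_1,x_2,x_3)=\sum_{s\in\mathcal{S}}w(s)x_1^{s_1}x_2^{s_2}x_3^{s_3}$, where $s=(s_1,s_2,s_3)$, and its covariance matrix is $$\mathrm{cov}(\chi_{\mathcal{S}})=\left(\frac{\partial_{ij}\chi_{\mathcal{S}}(\boldsymbol{x_0})}{\sqrt{\partial_{ii}\chi_{\mathcal{S}}(\boldsymbol{x_0})\,\partial_{jj}\chi_{\mathcal{S}}(\boldsymbol{x_0})}}\right)_{1\leq i,j\leq 3},\qquad \boldsymbol{x_0}=(1,1,1).$$ *)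

(* Defs.v *)
From HB Require Import structures.
From mathcomp Require Import all_boot all_order all_algebra.
From mathcomp Require Import all_classical all_reals all_analysis.
Import Order.TTheory GRing.Theory Num.Theory.
Import numFieldNormedType.Exports.

Set Implicit Arguments.
Unset Strict Implicit.
Unset Printing Implicit Defensive.

Local Open Scope ring_scope.

(* The finite type {-1,0,1}^d: the ordinal k : 'I_3 encodes the entry k - 1. *)
Definition step (d : nat) : finType := {ffun 'I_d -> 'I_3}.

Definition step_coord (d : nat) (s : step d) (i : 'I_d) : int :=
  (s i : nat)%:Z - 1.

Definition step_vec (R : realType) (d : nat) (s : step d) : 'rV[R]_d :=
  \row_i (step_coord s i)%:~R.

(* Values of [weight] outside [steps] are irrelevant. *)
Record small_step_model (R : realType) (d : nat) := SmallStepModel {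
  steps : {set step d};
  weight : step d -> R;
  weight_ge0 : forall s, s \in steps -> 0 <= weight s;
  weight_sum1 : \sum_(s in steps) weight s = 1;
  zero_drift : \sum_(s in steps) weight s *: step_vec R s = 0
}.

Definition non_degenerate (R : realType) (d : nat)
    (S : small_step_model R d) : Prop :=
  <<[seq step_vec R s | s in [set s in steps S | (0 < weight S s)%R]]>>%VS
    = fullv.

(* The Laurent polynomial as a function of (x_1, ..., x_d); the exponents are
   integers, with the convention 0 ^ (- n) = 0 for 0 < n. *)
Definition inventory (R : realType) (d : nat) (S : small_step_model R d)
    (x : 'rV[R]_d) : R :=
  \sum_(s in steps S) weight S s * \prod_i x ord0 i ^ step_coord s i.

Definition partial2 (R : realType) (d : nat) (i j : 'I_d)
    (f : 'rV[R]_d -> R) (x : 'rV[R]_d) : R :=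
  'D_(delta_mx ord0 i) ('D_(delta_mx ord0 j) f) x.

Definition cov (R : realType) (d : nat) (f : 'rV[R]_d -> R) : 'M[R]_d :=
  let x0 := const_mx 1 in
  \matrix_(i, j) (partial2 i j f x0 /
                  Num.sqrt (partial2 i i f x0 * partial2 j j f x0)).

Definition positive_definite (R : realType) (n : nat) (A : 'M[R]_n) : Prop :=
  A^T = A /\ forall u : 'rV[R]_n, u != 0 -> 0 < (u *m A *m u^T) ord0 ord0.

Definition delta_matrix (R : realType) (a b c : R) : 'M[R]_3 :=
  \matrix_(i, j)
    (nth [::] [:: [:: 1; - a; - b];
                  [:: - a; 1; - c];
                  [:: - b; - c; 1]] i)`_j.

(* Main.v *)
(* Because the drift vanishes, the second derivatives of the inventory at
   (1,1,1) are the second moments of the step distribution, so the covariance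
   matrix is a correlation matrix, and it is positive definite as soon as no
   hyperplane contains all steps of positive weight. Positive definiteness
   gives det delta > 0 by testing delta on the first row of its adjugate.

   Conversely, let v = adj(delta) (1,1,1)^T. All entries of adj(delta) are
   nonnegative, so v > 0, and delta v = (det delta) (1,1,1)^T. Hence
   diag(v) delta diag(v) has nonpositive off-diagonal entries and positive row
   sums v_i det delta: it is the sum of the rank-one matrices
   - delta_ij v_i v_j (e_i - e_j)(e_i - e_j)^T, i < j, and
   v_i (det delta) e_i e_i^T, that is, up to normalisation, the second moment
   matrix of a model on the steps +-(e_i - e_j) and +-e_i. Rescaling by v does
   not change the correlation matrix. *)
Require Import Defs.
From mathcomp Require Import all_boot all_order all_algebra.
From mathcomp Require Import all_classical all_reals all_analysis.
From mathcomp Require Import ring lra.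
Import Order.TTheory GRing.Theory Num.Theory.
Import numFieldNormedType.Exports.

Set Implicit Arguments.
Unset Strict Implicit.
Unset Printing Implicit Defensive.

Local Open Scope ring_scope.

(** * Directional derivatives of Laurent monomials *)

Lemma is_derive_coord (R : realType) (d : nat) (i : 'I_d) (x v : 'rV[R]_d) :
  is_derive x v (fun y : 'rV[R]_d => y ord0 i) (v ord0 i).
Proof.
suff cv : ((fun h : R => h^-1 *: (((fun y : 'rV[R]_d => y ord0 i) \o shift x)
    (h *: v) - x ord0 i)) @ (0 : R)^' --> v ord0 i)%classic.
  by split; [apply/cvg_ex; exists (v ord0 i) | exact/cvg_lim].
apply: (cvg_trans _ (@cvg_cst _ (v ord0 i) _ ((0 : R)^')%classic _)).
apply: near_eq_cvg; near=> h.
have h0 : h != 0 by near: h; exact: nbhs_dnbhs_neq.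
by rewrite /= !mxE addrK [_ *: _]mulKf.
Unshelve. all: by end_near. Qed.

Lemma is_derive_inv (R : realType) (V : normedModType R) (f : V -> R)
    (x v : V) (df : R) : f x != 0 -> is_derive x v f df ->
  is_derive x v (fun y => (f y)^-1) (- (f x) ^- 2 * df).
Proof.
move=> fx0 [dvf <-]; split; first exact: derivableV.
by rewrite deriveV.
Qed.

(** Written with the logarithmic derivative [df / f x], the formula treats both signs of [k] alike,
    avoids the exponent [k - 1], and fits [is_derive_prod]. *)
Lemma is_derive_exprz (R : realType) (V : normedModType R) (f : V -> R)
    (k : int) (x v : V) (df : R) : f x != 0 -> is_derive x v f df ->
  is_derive x v (fun y => f y ^ k) (k%:~R * (df / f x) * f x ^ k).
Proof.
move=> fx0 dvf.
have dX n : is_derive x v (fun y => f y ^+ n) (n%:R * (df / f x) * f x ^+ n).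
  rewrite (_ : (fun y => _) = f ^+ n); last first.
    by apply/funext => y; rewrite exprfctE.
  apply: is_derive_eq; transitivity (n%:R * f x ^+ n.-1 * df) => //.
  by case: n => [|n] /=; [rewrite !mul0r | rewrite exprS; field].
case: k => n; first exact: dX.
rewrite NegzE /=.
have fX0 : f x ^+ n.+1 != 0 by rewrite expf_neq0.
apply: is_derive_eq.
  exact: (is_derive_inv (f := fun y => f y ^+ n.+1)) fX0 (dX n.+1).
rewrite /= mulrNz -pmulrn -exprnN.
by move: fX0; set X := _ ^+ n.+1 => X0; field; rewrite X0.
Qed.

(** Logarithmic derivatives add up under products. *)
Lemma is_derive_prod (R : realType) (V : normedModType R) (I : Type)
    (r : seq I) (f : I -> V -> R) (lf : I -> R) (x v : V) :
  (forall i, is_derive x v (f i) (lf i * f i x)) ->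
  is_derive x v (fun y => \prod_(i <- r) f i y)
    ((\sum_(i <- r) lf i) * \prod_(i <- r) f i x).
Proof.
move=> df; elim: r => [|i r IHr].
  rewrite (_ : (fun y => _) = cst 1); last first.
    by apply/funext => y; rewrite big_nil.
  by rewrite !big_nil mul0r; exact: is_derive_cst.
rewrite (_ : (fun y => _) = f i * (fun y => \prod_(i <- r) f i y)); last first.
  by apply/funext => y; rewrite big_cons.
apply: is_derive_eq; rewrite !big_cons.
transitivity (f i x * ((\sum_(j <- r) lf j) * \prod_(j <- r) f j x) +
  (\prod_(j <- r) f j x) * (lf i * f i x)) => //; ring.
Qed.

Lemma is_derive_monomial (R : realType) (d : nat) (k : 'I_d -> int)
    (x : 'rV[R]_d) (j : 'I_d) : (forall i, x ord0 i != 0) ->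
  is_derive x (delta_mx ord0 j) (fun y : 'rV[R]_d => \prod_i y ord0 i ^ k i)
    ((k j)%:~R / x ord0 j * \prod_i x ord0 i ^ k i).
Proof.
move=> x0.
apply: is_derive_eq.
  apply: is_derive_prod => i.
  exact: is_derive_exprz (x0 i) (is_derive_coord _ _ _).
congr (_ * _); rewrite (bigD1 j) //= big1 ?addr0 => [|i ij].
  by rewrite mxE !eqxx mul1r.
by rewrite mxE (negPf ij) andbF mul0r mulr0.
Qed.

Lemma near_coord_neq0 (R : realType) (d : nat) (x : 'rV[R]_d) :
  (forall i, x ord0 i != 0) ->
  \forall y \near x, forall i, (y : 'rV[R]_d) ord0 i != 0.
Proof.
move=> x0.
apply: (@filter_forall 'rV[R]_d 'I_d (fun i y => y ord0 i != 0) (nbhs x)) => i.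
exact: cvgr_neq0 (@coord_continuous R 1 d ord0 i x) (x0 i).
Qed.

Lemma is_derive_bigsum (R : realType) (V : normedModType R) (I : Type)
    (r : seq I) (P : pred I) (f : I -> V -> R) (df : I -> R) (x v : V) :
  (forall i, is_derive x v (f i) (df i)) ->
  is_derive x v (fun y => \sum_(i <- r | P i) f i y)
    (\sum_(i <- r | P i) df i).
Proof.
move=> dvf; rewrite (_ : (fun y => _) = \sum_(i <- r | P i) f i).
  by elim/big_ind2: _ => // *; [exact: is_derive_cst | exact: is_deriveD].
by apply/funext => y; rewrite fct_sumE.
Qed.

(** * Second derivatives of the inventory as second moments *)

Lemma derive_inventory (R : realType) (d : nat) (S : small_step_model R d)
    (x : 'rV[R]_d) (j : 'I_d) : (forall i, x ord0 i != 0) ->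
  'D_(delta_mx ord0 j) (inventory S) x =
  \sum_(s in steps S) weight S s *
    ((step_coord s j)%:~R / x ord0 j * \prod_i x ord0 i ^ step_coord s i).
Proof.
move=> x0; apply: derive_val; apply: is_derive_bigsum => s.
exact: is_deriveZ (is_derive_monomial (step_coord s) j x0).
Qed.

Lemma drift_coord (R : realType) (d : nat) (S : small_step_model R d)
    (i : 'I_d) : \sum_(s in steps S) weight S s * (step_coord s i)%:~R = 0.
Proof.
have /rowP/(_ i) := zero_drift S; rewrite [RHS]mxE summxE => drift0.
by rewrite -[RHS]drift0; apply: eq_bigr => s _; rewrite !mxE.
Qed.

Lemma partial2_inventory (R : realType) (d : nat) (S : small_step_model R d)
    (i j : 'I_d) : partial2 i j (inventory S) (const_mx 1) =
  \sum_(s in steps S)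
    weight S s * ((step_coord s i)%:~R * (step_coord s j)%:~R).
Proof.
have one0 k : (const_mx 1 : 'rV[R]_d) ord0 k != 0 by rewrite mxE oner_neq0.
rewrite /partial2.
transitivity ('D_(delta_mx ord0 i) (fun x : 'rV[R]_d => \sum_(s in steps S)
    weight S s * ((step_coord s j)%:~R *
      ((x ord0 j)^-1 * \prod_k x ord0 k ^ step_coord s k))) (const_mx 1)).
  (* The formula for the first derivative is available only where no coordinate vanishes; a
     neighbourhood of the all-ones point suffices to differentiate again. *)
  apply: near_eq_derive; near=> x.
  rewrite derive_inventory; last by near: x; exact: near_coord_neq0.
  by apply: eq_bigr => s _; rewrite !mulrA.
apply: derive_val; apply: is_derive_eq.
  apply: is_derive_bigsum => s.
  apply: is_deriveZ; apply: is_deriveZ; apply: is_deriveM.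
    by apply: is_derive_inv (is_derive_coord _ _ _).
  exact: is_derive_monomial.
(* The term with [(j == i)%:R] comes from differentiating the inverse of [x ord0 j]; it sums to zero
   because the drift vanishes. *)
transitivity (\sum_(s in steps S) (weight S s *
    ((step_coord s i)%:~R * (step_coord s j)%:~R) -
  (weight S s * (step_coord s j)%:~R) * (j == i)%:R)).
  apply: eq_bigr => s _; rewrite !mxE eqxx /=.
  have -> : \prod_k (const_mx 1 : 'rV[R]_d) ord0 k ^ step_coord s k = 1.
    by rewrite big1 // => k _; rewrite mxE exp1rz.
  rewrite invr1 expr1n invr1 !mulr1.
  transitivity (weight S s * ((step_coord s j)%:~R *
    (1 * (step_coord s i)%:~R + 1 * (-1 * (j == i)%:R)))) => //; ring.
by rewrite sumrB -mulr_suml drift_coord mul0r subr0.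
Unshelve. all: by end_near. Qed.

(** * Positive definiteness of the covariance matrix *)

Lemma mulmx_tr_eq0 (R : realType) (d : nat) (u : 'rV[R]_d) :
  u *m u^T = 0 -> u = 0.
Proof.
move=> /matrixP/(_ ord0 ord0); rewrite !mxE => /eqP.
rewrite psumr_eq0 => [/allP u0|i _]; last by rewrite mxE -expr2 sqr_ge0.
apply/rowP => i; rewrite mxE; have := u0 i; rewrite mem_index_enum => /(_ isT).
by rewrite mxE mulf_eq0 orbb => /eqP.
Qed.

(** If every step of positive weight were orthogonal to [u], so would be their span, which is the
    whole space; then [u] would be orthogonal to itself. *)
Lemma non_degenerate_step (R : realType) (d : nat) (S : small_step_model R d)
    (u : 'rV[R]_d) : non_degenerate S -> u != 0 ->
  exists2 s, s \in steps S & 0 < weight S s /\ step_vec R s *m u^T != 0.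
Proof.
move=> ndS; apply: contraNP => nos; apply/eqP/mulmx_tr_eq0.
pose f := linfun (mulmxr u^T : 'rV[R]_d -> 'M[R]_1).
have : (fullv <= lker f)%VS.
  rewrite -ndS; apply/span_subvP => _ /mapP[s + ->].
  rewrite mem_enum inE => /andP[Ss ws]; rewrite memv_ker lfunE /=.
  by apply: contra_notT nos => su; exists s.
by move/subvP/(_ u (memvf u)); rewrite memv_ker lfunE => /eqP.
Qed.

Lemma step_vecM (R : realType) (d : nat) (s : step d) (u : 'rV[R]_d) :
  (step_vec R s *m u^T) ord0 ord0 = \sum_i u ord0 i * (step_coord s i)%:~R.
Proof. by rewrite mxE; apply: eq_bigr => i _; rewrite !mxE mulrC. Qed.

Lemma partial2_quadratic_gt0 (R : realType) (d : nat)
    (S : small_step_model R d) (u : 'rV[R]_d) : non_degenerate S -> u != 0 ->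
  0 < \sum_i \sum_j u ord0 i * u ord0 j *
        partial2 i j (inventory S) (const_mx 1).
Proof.
move=> ndS u0; have [s Ss [ws su]] := non_degenerate_step ndS u0.
(* The quadratic form at [u] is the expectation of the square of the inner product of the random
   step with [u]. *)
have -> : \sum_i \sum_j u ord0 i * u ord0 j *
      partial2 i j (inventory S) (const_mx 1) =
    \sum_(s in steps S) weight S s * (step_vec R s *m u^T) ord0 ord0 ^+ 2.
  under eq_bigr do under eq_bigr do rewrite partial2_inventory mulr_sumr.
  under eq_bigr do rewrite exchange_big.
  rewrite exchange_big; apply: eq_bigr => t _ /=.
  rewrite step_vecM expr2 big_distrlr mulr_sumr; apply: eq_bigr => i _.
  by rewrite mulr_sumr; apply: eq_bigr => j _ /=; ring.
rewrite (bigD1 s) //= ltr_pwDl //.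
  rewrite mulr_gt0 // exprn_even_gt0 //=; apply: contra_neq su => su.
  by apply/matrixP => i j; rewrite !ord1 su mxE.
by apply: sumr_ge0 => t /andP[St _]; rewrite mulr_ge0 ?sqr_ge0 ?weight_ge0.
Qed.

(** The normalised form at [u] is the form [m] at the vector with entries [u_i / sqrt (m i i)]; the
    diagonal of [m] is positive by testing on unit vectors. *)
Lemma correlation_positive_definite (R : realType) (d : nat)
    (m : 'I_d -> 'I_d -> R) :
  (forall i j, m i j = m j i) ->
  (forall u : 'rV[R]_d, u != 0 ->
    0 < \sum_i \sum_j u ord0 i * u ord0 j * m i j) ->
  positive_definite (\matrix_(i, j) (m i j / Num.sqrt (m i i * m j j))).
Proof.
move=> mC m_pos.
have m_gt0 i : 0 < m i i.
  have /m_pos : delta_mx ord0 i != 0 :> 'rV[R]_d.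
    by apply/eqP => /rowP/(_ i)/eqP; rewrite !mxE !eqxx oner_eq0.
  have dE j : (delta_mx ord0 i : 'rV[R]_d) ord0 j = (j == i)%:R by rewrite mxE.
  rewrite (bigD1 i) //= [X in _ + X]big1 ?addr0 => [|j /negPf ji].
    rewrite (bigD1 i) //= [X in _ + X]big1 ?addr0 => [|j /negPf ji].
      by rewrite !dE eqxx !mul1r.
    by rewrite !dE ji mulr0 mul0r.
  by rewrite big1 // => k _; rewrite !dE ji !mul0r.
split=> [|u u0].
  by apply/matrixP => i j; rewrite !mxE [m j i]mC [m j j * _]mulrC.
pose v : 'rV[R]_d := \row_i (u ord0 i / Num.sqrt (m i i)).
have v0 : v != 0.
  apply: contra_neq u0 => /rowP v0; apply/rowP => i; have /eqP := v0 i.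
  by rewrite !mxE mulf_eq0 invr_eq0 sqrtr_eq0 leNgt m_gt0 orbF => /eqP.
have := m_pos v v0; congr (_ < _).
rewrite [RHS]mxE exchange_big; apply: eq_bigr => j _ /=.
rewrite !mxE mulr_suml; apply: eq_bigr => i _.
by rewrite !mxE sqrtrM ?(ltW (m_gt0 i)) // invfM; ring.
Qed.

Lemma cov_positive_definite (R : realType) (d : nat)
    (S : small_step_model R d) :
  non_degenerate S -> positive_definite (cov (inventory S)).
Proof.
move=> ndS; apply: correlation_positive_definite => [i j|u u0].
  rewrite !partial2_inventory; apply: eq_bigr => s _.
  by rewrite [X in _ * X]mulrC.
exact: partial2_quadratic_gt0.
Qed.

(** * From positive definiteness to the inequality *)

Lemma delta_matrix_quadratic (R : realType) (a b c : R) (u : 'rV[R]_3) :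
  let x := u ord0 ord0 in let y := u ord0 1 in let z := u ord0 ord_max in
  (u *m delta_matrix a b c *m u^T) ord0 ord0 =
  x ^+ 2 + y ^+ 2 + z ^+ 2 - 2 * (a * x * y + b * x * z + c * y * z).
Proof.
rewrite /= !mxE !big_ord_recl big_ord0 !mxE !big_ord_recl !big_ord0 !mxE.
have -> : lift ord0 (lift ord0 ord0) = ord_max :> 'I_3 by apply/val_inj.
have -> : lift ord0 ord0 = 1 :> 'I_3 by apply/val_inj.
rewrite /=; ring.
Qed.

Lemma positive_definite_delta_matrix (R : realType) (a b c : R) :
  positive_definite (delta_matrix a b c) ->
  a ^+ 2 + b ^+ 2 + c ^+ 2 + 2 * a * b * c < 1.
Proof.
move=> [_ pd]; pose r x y z : 'rV[R]_3 := \row_i [:: x; y; z]`_i.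
have quad_gt0 x y z : r x y z != 0 ->
    0 < x ^+ 2 + y ^+ 2 + z ^+ 2 - 2 * (a * x * y + b * x * z + c * y * z).
  by move/pd; rewrite delta_matrix_quadratic !mxE.
have c_lt1 : 0 < 1 - c ^+ 2.
  have /quad_gt0 : r 0 c 1 != 0.
    by apply/eqP => /rowP/(_ ord_max)/eqP; rewrite !mxE oner_eq0.
  by congr (_ < _); ring.
(* The test vector is the first row of the adjugate of [delta_matrix a b c]. *)
have /quad_gt0 : r (1 - c ^+ 2) (a + b * c) (b + a * c) != 0.
  by apply/eqP => /rowP/(_ ord0)/eqP; rewrite !mxE gt_eqF.
(* This vector times the matrix is its determinant times the first unit vector, so the form takes
   the value (1 - c^2) det there, with 1 - c^2 > 0. *)
move=> adj_gt0; rewrite -subr_gt0 -(pmulr_rgt0 _ c_lt1); move: adj_gt0.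
by congr (_ < _); ring.
Qed.

(** * Construction of a model from the inequality *)

Definition opp_step (d : nat) (s : step d) : step d :=
  [ffun i => rev_ord (s i)].

Lemma step_coord_opp (d : nat) (s : step d) (i : 'I_d) :
  step_coord (opp_step s) i = - step_coord s i.
Proof. by rewrite /step_coord ffunE; case: (s i) => [[|[|[|]]]]. Qed.

(** Sharing [W k] equally between [V k] and its opposite kills the drift and keeps the second
    moments, which are even in the step. The weight of a step collects all indices that yield it, so
    [V] may repeat values. *)
Lemma exists_symmetric_model (R : realType) (d : nat) (I : finType)
    (V : I -> step d) (W : I -> R) :
  (forall k, 0 <= W k) -> \sum_k W k = 1 ->
  exists S : small_step_model R d,
    (forall k, 0 < W k -> V k \in steps S /\ 0 < weight S (V k)) /\
    forall i j, partial2 i j (inventory S) (const_mx 1) =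
      \sum_k W k * ((step_coord (V k) i)%:~R * (step_coord (V k) j)%:~R).
Proof.
move=> W_ge0 W1.
pose w s := \sum_k W k / 2 * ((s == V k)%:R + (s == opp_step (V k))%:R).
have wE (U : lmodType R) (f : step d -> U) :
    \sum_(s in [set: step d]) w s *: f s =
    \sum_k (W k / 2) *: (f (V k) + f (opp_step (V k))).
  under eq_bigr do rewrite scaler_suml.
  rewrite exchange_big; apply: eq_bigr => k _ /=.
  under eq_bigr do rewrite -scalerA.
  rewrite -scaler_sumr; congr (_ *: _).
  under eq_bigr do rewrite scalerDl.
  rewrite big_split /=; congr (_ + _).
    rewrite (bigD1 (V k)) ?inE //= eqxx scale1r big1 ?addr0 // => s /andP[_ sV].
    by rewrite (negPf sV) scale0r.
  rewrite (bigD1 (opp_step (V k))) ?inE //= eqxx scale1r big1 ?addr0 //.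
  by move=> s /andP[_ sV]; rewrite (negPf sV) scale0r.
have wER (f : step d -> R) : \sum_(s in [set: step d]) w s * f s =
    \sum_k (W k / 2) * (f (V k) + f (opp_step (V k))).
  exact: (wE R^o f).
have term_ge0 s k : 0 <= W k / 2 * ((s == V k)%:R + (s == opp_step (V k))%:R).
  by rewrite mulr_ge0 ?divr_ge0 ?addr_ge0 ?ler0n.
have w_ge0 s : s \in [set: step d] -> 0 <= w s.
  by move=> _; apply: sumr_ge0 => k _.
have w1 : \sum_(s in [set: step d]) w s = 1.
  rewrite -W1; under eq_bigr do rewrite -[w _]mulr1.
  by rewrite (wER (fun=> 1)); apply: eq_bigr => k _; field.
have w0 : \sum_(s in [set: step d]) w s *: step_vec R s = 0.
  rewrite wE big1 // => k _; rewrite (_ : _ + _ = 0) ?scaler0 //.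
  by apply/rowP => i; rewrite !mxE step_coord_opp mulrNz subrr.
exists (SmallStepModel w_ge0 w1 w0); split=> [k Wk|i j].
  rewrite inE; split=> //=; rewrite /w (bigD1 k) //= ltr_pwDl ?sumr_ge0 //.
  by rewrite eqxx mulr_gt0 ?divr_gt0 ?ltr_pwDl ?ler0n.
rewrite partial2_inventory.
rewrite (wER (fun s => (step_coord s i)%:~R * (step_coord s j)%:~R)).
by apply: eq_bigr => k _; rewrite !step_coord_opp !mulrNz; field.
Qed.

Lemma non_degenerate_unit_steps (R : realType) (d : nat)
    (S : small_step_model R d) (e : 'I_d -> step d) :
  (forall i, step_vec R (e i) = delta_mx ord0 i) ->
  (forall i, e i \in steps S /\ 0 < weight S (e i)) -> non_degenerate S.
Proof.
move=> eE Se; apply/eqP; rewrite eqEsubv subvf; apply/subvP => v _.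
rewrite [v]row_sum_delta; apply: memv_suml => i _; apply: memvZ.
rewrite -eE; apply: memv_span; apply/mapP; exists (e i) => //.
by rewrite mem_enum inE; apply/andP.
Qed.

(** The steps e_1, e_2, e_3, e_1 - e_2, e_1 - e_3, e_2 - e_3, with entries shifted by one as [step]
    requires. *)
Definition difference_step (k : 'I_6) : step 3 :=
  [ffun i : 'I_3 => inZp (nth 0%N (nth [::]
    [:: [:: 2; 1; 1]; [:: 1; 2; 1]; [:: 1; 1; 2];
        [:: 2; 0; 1]; [:: 2; 1; 0]; [:: 1; 2; 0]]%N k) i)].

Lemma step_coord_difference (k : 'I_6) (i : 'I_3) :
  step_coord (difference_step k) i =
  (nth [::] [:: [:: 1; 0; 0]; [:: 0; 1; 0]; [:: 0; 0; 1];
                [:: 1; -1; 0]; [:: 1; 0; -1]; [:: 0; 1; -1]] k)`_i.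
Proof.
rewrite /step_coord ffunE.
by case: k => [[|[|[|[|[|[|]]]]]] ?] //; case: i => [[|[|[|]]] ?].
Qed.

Lemma delta_matrix_cov (R : realType) (a b c : R) :
  0 <= a -> 0 <= b -> 0 <= c ->
  a ^+ 2 + b ^+ 2 + c ^+ 2 + 2 * a * b * c < 1 ->
  exists S : small_step_model R 3,
    non_degenerate S /\ delta_matrix a b c = cov (inventory S).
Proof.
move=> a0 b0 c0 lt1.
pose D := 1 - (a ^+ 2 + b ^+ 2 + c ^+ 2 + 2 * a * b * c).
have D0 : 0 < D by rewrite subr_gt0.
have abc0 : 0 <= a * b * c by rewrite !mulr_ge0.
have ab0 : 0 <= a * b by rewrite mulr_ge0.
have ac0 : 0 <= a * c by rewrite mulr_ge0.
have bc0 : 0 <= b * c by rewrite mulr_ge0.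
(* The row sums of the adjugate. *)
pose v (i : 'I_3) := [:: 1 - c ^+ 2 + (a + b * c) + (b + a * c);
  (a + b * c) + (1 - b ^+ 2) + (c + a * b);
  (b + a * c) + (c + a * b) + (1 - a ^+ 2)]`_i.
(* Each row sum is at least its diagonal cofactor, such as 1 - c^2, which is positive by [lt1] and
   [abc0]. *)
have v_gt0 i : 0 < v i.
  have a2 := sqr_ge0 a; have b2 := sqr_ge0 b; have c2 := sqr_ge0 c.
  by case: i => [[|[|[|]]] ?] //; rewrite /v /=; lra.
pose v0 := v ord0; pose v1 := v 1; pose v2 := v ord_max.
pose W (k : 'I_6) := [:: v0 * D; v1 * D; v2 * D;
  a * v0 * v1; b * v0 * v2; c * v1 * v2]`_k.
have [v0_gt0 v1_gt0] : 0 < v0 /\ 0 < v1 by split; exact: v_gt0.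
have v2_gt0 : 0 < v2 by exact: v_gt0.
have W_ge0 k : 0 <= W k.
  case: k => [[|[|[|[|[|[|]]]]]] ?] //; rewrite /W /=;
  by rewrite ?mulr_ge0 // ltW.
have W_gt0 i : 0 < W (widen_ord (isT : (3 <= 6)%N) i).
  by case: i => [[|[|[|]]] ?] //; rewrite /W /= mulr_gt0.
pose T := \sum_k W k.
have T_gt0 : 0 < T.
  rewrite /T (bigD1 ord0) //= ltr_pwDl ?sumr_ge0 //.
  by have := W_gt0 ord0; congr (0 < W _); apply: val_inj.
have [|| S [S_pos SE]] := @exists_symmetric_model R 3 'I_6 difference_step
    (fun k => T^-1 * W k).
- by move=> k; rewrite mulr_ge0 // invr_ge0 ltW.
- by rewrite -mulr_sumr mulVf // gt_eqF.
exists S; split.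
  pose e (i : 'I_3) := difference_step (widen_ord (isT : (3 <= 6)%N) i).
  apply: (@non_degenerate_unit_steps _ _ _ e) => i; last first.
    by apply: S_pos; rewrite mulr_gt0 ?invr_gt0.
  apply/rowP => j; rewrite !mxE step_coord_difference.
  by case: i => [[|[|[|]]] ?] //; case: j => [[|[|[|]]] ?].
(* Off the diagonal only one difference step contributes. On the diagonal the identity is [v i]
   times a row of delta v = D (1,1,1)^T. *)
have mE i j : partial2 i j (inventory S) (const_mx 1) =
    T^-1 * (delta_matrix a b c i j * v i * v j).
  rewrite SE; under eq_bigr do rewrite -mulrA.
  rewrite -mulr_sumr; congr (_ * _).
  rewrite !big_ord_recl big_ord0 !step_coord_difference.
  rewrite mxE /W /v0 /v1 /v2 /v /D /=.
  by case: i => [[|[|[|]]] ?] //; case: j => [[|[|[|]]] ?] //=; ring.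
apply/matrixP => i j; rewrite [RHS]mxE !mE.
have delta1 k : delta_matrix a b c k k = 1.
  by rewrite mxE; case: k => [[|[|[|]]] ?].
rewrite !delta1 !mul1r.
(* The product under the root is a perfect square, so [T] and [v] cancel from the correlation. *)
have -> : T^-1 * (v i * v i) * (T^-1 * (v j * v j)) = (T^-1 * v i * v j) ^+ 2.
  by ring.
rewrite sqrtr_sqr ger0_norm; last by rewrite !mulr_ge0 ?invr_ge0 ?ltW.
by field; rewrite !gt_eqF.
Qed.

Theorem theorem5 (R : realType) (a b c : R)
    (a_ge0 : 0 <= a) (b_ge0 : 0 <= b) (c_ge0 : 0 <= c) :
  [<-> exists S : small_step_model R 3,
         non_degenerate S /\ delta_matrix a b c = cov (inventory S);
       a ^+ 2 + b ^+ 2 + c ^+ 2 + 2 * a * b * c < 1;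
       positive_definite (delta_matrix a b c)].
Proof.
(* The direct implications run from model to positive definite to inequality to model. The stated
   cycle runs the other way, so each of its arrows composes two of these. *)
have model_pd : (exists S : small_step_model R 3,
    non_degenerate S /\ delta_matrix a b c = cov (inventory S)) ->
    positive_definite (delta_matrix a b c).
  by move=> [S [ndS ->]]; exact: cov_positive_definite.
tfae=> [/model_pd|lt1|/positive_definite_delta_matrix lt1].
- exact: positive_definite_delta_matrix.
- exact/model_pd/delta_matrix_cov.
- exact: delta_matrix_cov.
Qed.
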